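(* Let $X$ be a geodesic space, $C\subseteq X$ a convex subset, $T:C\to C$ a nonexpansive mapping, $u,x_0\in C$, and $(\lambda_n)_{n\ge 1}$ a sequence in $[0,1]$. Define $(x_n)_{n\ge 0}$ by $x_{n+1}=T(\lambda_{n+1}u+(1-\lambda_{n+1})x_n)$ for $n\ge 0$, and define $(y_n)_{n\ge 1}$ by $y_{n+1}=\lambda_{n+1}u+(1-\lambda_{n+1})x_n$ for $n\ge 0$. If $(y_n)$ converges strongly to a fixed point $p$ of $T$, then $(x_n)$ also converges strongly to $p$.
   Context: A geodesic space is a metric space $(X,d)$ in which any two points are joined by a geodesic segment. For every pair of points $x,y\in X$ a geodesic segment joining them is fixed (when it is unique, it is that one), and for $\lambda\in[0,1]$ the notation $\lambda x+(1-\lambda)y$ denotes the point $z$ on this segment with $d(x,z)=(1-\lambda)d(x,y)$ and $d(y,z)=\lambda d(x,y)$; thus $\lambda x+(1-\lambda)y$ is determined by $(\lambda,x,y)$. A subset $C\subseteq X$ is convex if every geodesic segment joining two points of $C$ is contained in $C$. A mapping $T:C\to C$ is nonexpansive if $d(Tx,Ty)\le d(x,y)$ for all $x,y\in C$. A fixed point of $T$ is a point $p\in C$ with $Tp=p$. Strong convergence means convergence in the metric $d$. *)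

(* Defs.v *)
From HB Require Import structures.
From mathcomp Require Import all_boot all_order all_algebra.
From mathcomp Require Import all_classical all_reals all_analysis.

Set Implicit Arguments.
Unset Strict Implicit.
Unset Printing Implicit Defensive.

Import Order.TTheory GRing.Theory Num.Theory.
Import numFieldNormedType.Exports.

Local Open Scope classical_set_scope.
Local Open Scope ring_scope.

Section geodesic.
Context {R : realType} {X : metricType R}.
Implicit Types (x y z u p : X) (C : set X) (T : X -> X) (l : R).

(* Only the values of c on [0, d(x, y)] matter. *)
Definition geodesic_path x y (c : R -> X) : Prop :=
  [/\ c 0 = x, c (mdist x y) = y &
      {in `[0, mdist x y] &, forall s t, mdist (c s) (c t) = `|s - t|}].

Definition geodesic_segment x y (S : set X) : Prop :=
  exists2 c : R -> X, geodesic_path x y c & S = c @` `[0, mdist x y].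

(* Every geodesic segment between two points of C counts here, not only the
   one selected by a [geodesic_choice]. *)
Definition geodesic_convex C : Prop :=
  forall x y S, C x -> C y -> geodesic_segment x y S -> S `<=` C.

(* seg x y is the segment fixed once and for all for the pair (x, y); nothing
   relates seg x y to seg y x. *)
Definition geodesic_choice (seg : X -> X -> set X) : Prop :=
  forall x y, geodesic_segment x y (seg x y).

Definition is_convex_comb (seg : X -> X -> set X) l x y z : Prop :=
  [/\ seg x y z, mdist x z = (1 - l) * mdist x y
    & mdist y z = l * mdist x y].

(* The point l x + (1 - l) y, which for 0 <= l <= 1 exists and is unique
   (convex_combP, convex_comb_unique); the default x is never used then. *)
Definition convex_comb (seg : X -> X -> set X) l x y : X :=
  xget x [set z | is_convex_comb seg l x y z].

Definition nonexpansive_on C T : Prop :=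
  {in C &, forall x y, mdist (T x) (T y) <= mdist x y}.

Definition fixed_point_in C T p : Prop := C p /\ T p = p.

Lemma convex_comb_unique seg l x y z z' : geodesic_choice seg ->
  is_convex_comb seg l x y z -> is_convex_comb seg l x y z' -> z = z'.
Proof.
move=> hseg [+ + _] [+ + _]; have [c [c0 _ cd] ->] := hseg x y.
have I0 : 0 \in `[0, mdist x y] by rewrite in_itv /= lexx mdist_ge0.
have dc t : t \in `[0, mdist x y] -> mdist x (c t) = t.
  move=> It; rewrite -{1}c0 cd // sub0r normrN ger0_norm //.
  by move: It; rewrite in_itv /= => /andP[].
move=> [s Is <-] ds [t It <-] dt.
by congr c; rewrite -(dc s) // -(dc t) // ds dt.
Qed.

Lemma convex_combP seg l x y : geodesic_choice seg -> 0 <= l <= 1 ->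
  is_convex_comb seg l x y (convex_comb seg l x y).
Proof.
move=> hseg /andP[l0 l1].
suff [z hz] : exists z, is_convex_comb seg l x y z.
  exact: (@xgetPex _ x [set z | is_convex_comb seg l x y z]) (ex_intro _ z hz).
rewrite /is_convex_comb; have [c [c0 c1 cd] ->] := hseg x y.
set d := mdist x y in c1 cd *.
have d0 : 0 <= d by exact: mdist_ge0.
have I0 : 0 \in `[0, d] by rewrite in_itv /= lexx d0.
have I1 : d \in `[0, d] by rewrite in_itv /= lexx d0.
have It : (1 - l) * d \in `[0, d].
  by rewrite in_itv /= mulr_ge0 ?subr_ge0 //= ler_piMl // gerBl.
exists (c ((1 - l) * d)); split; first by exists ((1 - l) * d).
  by rewrite -{1}c0 cd // sub0r normrN ger0_norm // mulr_ge0 // subr_ge0.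
by rewrite -{1}c1 cd // mulrBl mul1r subKr ger0_norm // mulr_ge0.
Qed.

End geodesic.

Definition geodesic_space {R : realType} (X : metricType R) : Prop :=
  forall x y : X, exists S : set X, geodesic_segment x y S.

(* Main.v *)
Require Import Defs.
From HB Require Import structures.
From mathcomp Require Import all_boot all_order all_algebra.
From mathcomp Require Import all_classical all_reals all_analysis.

Set Implicit Arguments.
Unset Strict Implicit.
Unset Printing Implicit Defensive.

Import Order.TTheory GRing.Theory Num.Theory.
Import numFieldNormedType.Exports.

Local Open Scope classical_set_scope.
Local Open Scope ring_scope.

(** For [n >= 1] the iterate [x n] is [T (y n)], and [p = T p], so nonexpansiveness gives
    [d(p, x n) <= d(p, y n)]: every ball around [p] that contains [y n] contains [x n].
    Nonexpansiveness is available only on [C], so both sequences must be kept there;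
    [geodesic_convex_comb] does this for the averaging step, since the chosen segment between two
    points of [C] is itself a geodesic segment. *)

Lemma geodesic_convex_comb (R : realType) (X : metricType R)
    (seg : X -> X -> set X) (C : set X) (l : R) (x y : X) :
  geodesic_choice seg -> geodesic_convex C -> 0 <= l <= 1 ->
  C x -> C y -> C (convex_comb seg l x y).
Proof.
move=> hseg hC hl Cx Cy; have [segz _ _] := convex_combP x y hseg hl.
exact: hC Cx Cy (hseg x y) _ segz.
Qed.

Theorem mainTheorem2 (R : realType) (X : metricType R)
  (hX : geodesic_space X)
  (seg : X -> X -> set X) (hseg : geodesic_choice seg)
  (C : set X) (hC : geodesic_convex C)
  (T : X -> X) (hTC : set_fun C C T) (hT : nonexpansive_on C T)
  (u x0 : X) (hu : C u) (hx0 : C x0)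
  (lambda : nat -> R)
  (hlambda : forall n : nat, (1 <= n)%N -> 0 <= lambda n <= 1)
  (x y : nat -> X)
  (hx_init : x 0%N = x0)
  (hx : forall n : nat, x n.+1 = T (convex_comb seg (lambda n.+1) u (x n)))
  (hy : forall n : nat, y n.+1 = convex_comb seg (lambda n.+1) u (x n))
  (p : X) (hp : fixed_point_in C T p)
  (hyp : y n @[n --> \oo] --> p) :
  x n @[n --> \oo] --> p.
Proof.
have [Cp Tp] := hp.
have Cx n : C (x n).
  elim: n => [|n IHn]; first by rewrite hx_init.
  rewrite hx; apply: hTC.
  exact: geodesic_convex_comb hseg hC (hlambda n.+1 isT) hu IHn.
have Cy n : C (y n.+1).
  rewrite hy; exact: geodesic_convex_comb hseg hC (hlambda n.+1 isT) hu (Cx n).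
(* Index 0 is excluded because [y 0] is arbitrary: [hy] constrains [y] only from index 1 on. *)
have dxy n : (0 < n)%N -> mdist p (x n) <= mdist p (y n).
  (* Only the left-hand [p] is replaced by [T p], which puts the goal in the form of [hT] at [p] and
     [y n.+1]. *)
  by case: n => // n _; rewrite hx -hy -{1}Tp; apply: hT; rewrite inE.
apply/cvg_ballP => e e0; move/cvg_ballP: hyp => /(_ e e0).
apply: filterS2 (nbhs_infty_gt 0) => n n0; rewrite !ballEmdist /=.
exact/le_lt_trans/dxy.
Qed.
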